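(* The limit of $\Gamma_{\mathbb{H}^2}$ as $x$ goes to infinity is given by $$\lim_{x\to\infty}\Gamma_{\mathbb{H}^2}(x)=\ln 2.$$
   Context: $\mathbb{H}^2$ is the hyperbolic plane: the complete, simply connected Riemannian surface of constant curvature $-1$, viewed as a metric space with its geodesic distance. A quadruple $\square=\{a,b,c,d\}$ in a metric space $(X,d)$ is a choice of four (not necessarily distinct) points of $X$. Its three pairwise distance sums are $d(a,b)+d(c,d)$, $d(a,c)+d(b,d)$, $d(a,d)+d(b,c)$; label them so that $S\le M\le L$, and set $\delta(\square)=\frac{L-M}{2}$. The diameter $D(\square)$ is the largest distance between two points of $\square$. Let $\mathrm{Dist}_X=\{d(a,b):a,b\in X\}\subset[0,\infty)$, and define $\Gamma_X:\mathrm{Dist}_X\to\mathbb{R}$ by $$\Gamma_X(x)=\sup_{\square\subset X:\,D(\square)=x}\delta(\square).$$ For $X=\mathbb{H}^2$, $\mathrm{Dist}_X=[0,\infty)$. *)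

(* Defs.v *)
From Stdlib Require Import Reals.
From Coquelicot Require Import Coquelicot.
Open Scope R_scope.

Section FourPoint.

Variables (X : Type) (d : X -> X -> R).

Definition sum_ab_ce (a b c e : X) : R := d a b + d c e.
Definition sum_ac_be (a b c e : X) : R := d a c + d b e.
Definition sum_ae_bc (a b c e : X) : R := d a e + d b c.

Definition largest_sum (a b c e : X) : R :=
  Rmax (sum_ab_ce a b c e) (Rmax (sum_ac_be a b c e) (sum_ae_bc a b c e)).

Definition smallest_sum (a b c e : X) : R :=
  Rmin (sum_ab_ce a b c e) (Rmin (sum_ac_be a b c e) (sum_ae_bc a b c e)).

(* What is left of the three sums once a largest and a smallest one have been
   removed; ties are thus counted with multiplicity. *)
Definition middle_sum (a b c e : X) : R :=
  sum_ab_ce a b c e + sum_ac_be a b c e + sum_ae_bc a b c e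
  - largest_sum a b c e - smallest_sum a b c e.

Definition delta (a b c e : X) : R :=
  (largest_sum a b c e - middle_sum a b c e) / 2.

Definition diameter (a b c e : X) : R :=
  Rmax (Rmax (d a b) (Rmax (d a c) (d a e)))
       (Rmax (d b c) (Rmax (d b e) (d c e))).

(* For a metric [d] and [x] one of its values, the supremum is over a nonempty
   set bounded by [x], so [real] returns it unchanged. When [x] is not a value
   of [d], outside the domain of Gamma, the set is empty and the result is 0. *)
Definition Gamma (x : R) : R :=
  real (Lub_Rbar (fun r => exists a b c e : X,
                    diameter a b c e = x /\ r = delta a b c e)).

End FourPoint.

(* The upper half-plane model: {y > 0} with the Riemannian metric
   (dx^2 + dy^2) / y^2, which is complete of constant curvature -1. *)
Record H2 : Type := mkH2 { xco : R; yco : R; yco_pos : 0 < yco }.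

(* Differentiability at the endpoints 0 and 1 is two-sided; this loses no
   curve, since a C^1 function on [0, 1] extends to a C^1 function on R. *)
Definition C1_on_unit (f : R -> R) : Prop :=
  forall t : R, 0 <= t <= 1 -> ex_derive f t /\ continuous (Derive f) t.

Definition is_C1_path (p q : H2) (u v : R -> R) : Prop :=
  C1_on_unit u /\ C1_on_unit v /\
  (forall t : R, 0 <= t <= 1 -> 0 < v t) /\
  u 0 = xco p /\ v 0 = yco p /\ u 1 = xco q /\ v 1 = yco q.

Definition path_length (u v : R -> R) : R :=
  RInt (fun t => sqrt ((Derive u t) ^ 2 + (Derive v t) ^ 2) / v t) 0 1.

(* The lengths form a nonempty set (it contains that of the Euclidean segment)
   bounded below by 0, so [real] returns the infimum unchanged. *)
Definition dist_H2 (p q : H2) : R :=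
  real (Glb_Rbar (fun l => exists u v : R -> R,
                    is_C1_path p q u v /\ l = path_length u v)).

(* Main.v *)
Require Import Defs.
From Stdlib Require Import Reals Lra Psatz.
From Coquelicot Require Import Coquelicot.
Open Scope R_scope.

(** Write [d] for the hyperbolic distance. Both bounds rest on the closed
    formula
      cosh d(p, q) = 1 + |p - q|^2 / (2 y_p y_q)      ([cosh_dist_H2]).
    It is obtained from the definition of [d] as an infimum of lengths by
    calibration: the Busemann function of an ideal point is 1-Lipschitz for the
    hyperbolic metric, so its variation bounds the length of every path from
    below ([length_ge_busemann]), and along a geodesic ending at that ideal point
    it varies at unit speed, so that the bound is attained
    ([dist_H2_semicircle], [dist_H2_vertical]).

    Upper bound. The half-angle formulas turn the closed formula into
      exp (d(p, q) / 2) = (|p - q| + |p - q*|) / (2 sqrt (y_p y_q)),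
    where q* is the complex conjugate of q. Applying the Euclidean Ptolemy
    inequality to the quadruples obtained by conjugating some of the points
    gives a Ptolemy inequality for exp (d / 2) ([exp_ptolemy_H2]), that is,
      exp (L / 2) <= exp (M / 2) + exp (S / 2) <= 2 exp (M / 2)
    for the three distance sums of a quadruple. Hence (L - M) / 2 <= ln 2 for
    every quadruple, whatever its diameter ([delta_H2_le_ln2]).

    Lower bound. A regular quadrilateral with diagonals x has diameter x and
    sides s with cosh s = (1 + cosh x) / 2 ([exists_square]); its two sums of
    opposite sides are 2 s, so its delta is x - s. Since exp s <= 2 cosh s, this
    is at least x - ln (1 + cosh x), which tends to ln 2. *)

(** * Hyperbolic trigonometry *)

Lemma cosh_pos (a : R) : 0 < cosh a.
Proof. unfold cosh. assert (H1 := exp_pos a). assert (H2 := exp_pos (- a)). lra. Qed.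

Lemma cosh_sqr (a : R) : cosh a ^ 2 = 1 + sinh a ^ 2.
Proof.
  unfold cosh, sinh.
  assert (exp a * exp (- a) = 1) by (rewrite <- exp_plus, <- exp_0; f_equal; ring).
  nra.
Qed.

Lemma cosh_nonneg_le (a b : R) : 0 <= a -> 0 <= b -> cosh a <= cosh b -> a <= b.
Proof.
  intros Ha Hb Hc. destruct (Rle_or_lt a b) as [|Hlt]; [easy|exfalso].
  assert (Hs : sinh b < sinh a) by now apply sinh_lt.
  assert (Hb0 : 0 <= sinh b)
    by (rewrite <- sinh_0; destruct Hb as [Hb | <-]; [left; now apply sinh_lt | lra]).
  assert (H1 := cosh_sqr a). assert (H2 := cosh_sqr b).
  assert (0 < cosh a) by apply cosh_pos. assert (0 < cosh b) by apply cosh_pos.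
  nra.
Qed.

Lemma cosh_nonneg_inj (a b : R) : 0 <= a -> 0 <= b -> cosh a = cosh b -> a = b.
Proof. intros; apply Rle_antisym; apply cosh_nonneg_le; lra. Qed.

Lemma cosh_minus (a b : R) : cosh (a - b) = cosh a * cosh b - sinh a * sinh b.
Proof.
  unfold cosh, sinh. replace (- (a - b)) with (- a + b) by ring.
  unfold Rminus at 1. rewrite !exp_plus. field.
Qed.

Lemma cosh_Rabs (a : R) : cosh (Rabs a) = cosh a.
Proof.
  unfold Rabs; destruct Rcase_abs; [|easy].
  unfold cosh; rewrite Ropp_involutive; lra.
Qed.

Lemma cosh_sinh_double (a : R) :
  cosh (2 * a) = 1 + 2 * sinh a ^ 2 /\ cosh (2 * a) = 2 * cosh a ^ 2 - 1.
Proof.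
  unfold cosh, sinh. replace (2 * a) with (a + a) by ring.
  replace (- (a + a)) with (- a + - a) by ring. rewrite !exp_plus.
  assert (exp a * exp (- a) = 1) by (rewrite <- exp_plus, <- exp_0; f_equal; ring).
  split; nra.
Qed.

Lemma exp_eq_cosh_sinh (a : R) : exp a = cosh a + sinh a.
Proof. unfold cosh, sinh; field. Qed.

Lemma exp_le_iff (a b : R) : exp a <= exp b <-> a <= b.
Proof.
  split; intros [H | H].
  - left. now apply exp_lt_inv.
  - right. now apply exp_inv.
  - left. now apply exp_increasing.
  - right. now f_equal.
Qed.

(** * Lower bounds on the length of a path *)

Ltac cont :=
  repeat first
    [ assumption
    | apply continuous_const
    | apply continuous_sqrt_comp
    | apply @continuous_plus
    | apply @continuous_opp
    | apply (@continuous_mult _ R_AbsRing) ].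

Lemma continuous_ratio (f g : R -> R) (x : R) :
  continuous f x -> continuous g x -> g x <> 0 ->
  continuous (fun t => f t / g t) x.
Proof.
  intros Hf Hg Hx. apply (@continuous_mult _ R_AbsRing); [easy|].
  now apply continuous_Rinv_comp.
Qed.

Lemma continuous_Derive_C1 (f : R -> R) (t : R) :
  C1_on_unit f -> 0 <= t <= 1 -> continuous f t /\ continuous (Derive f) t.
Proof.
  intros Hf Ht. destruct (Hf t Ht) as [H1 H2]. split; [|easy].
  now apply (ex_derive_continuous (V := R_NormedModule)).
Qed.

Definition speed (u v : R -> R) (t : R) : R :=
  sqrt ((Derive u t) ^ 2 + (Derive v t) ^ 2) / v t.

(** [g] stands for the value along the path of a function on the plane that is
    1-Lipschitz for the hyperbolic metric: its total variation is the integral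
    of a derivative that never exceeds the speed of the path. *)
Lemma length_ge_calibration (p q : H2) (u v g dg : R -> R) :
  is_C1_path p q u v ->
  (forall t, 0 <= t <= 1 -> is_derive g t (dg t)) ->
  (forall t, 0 <= t <= 1 -> continuous dg t) ->
  (forall t, 0 <= t <= 1 -> Rabs (dg t) <= speed u v t) ->
  Rabs (g 1 - g 0) <= path_length u v.
Proof.
  intros (Hu & Hv & Hpos & _) Hg Hdg Hle.
  assert (HI : is_RInt dg 0 1 (g 1 - g 0)).
  { apply (is_RInt_derive g dg); intros x; rewrite Rmin_left, Rmax_right by lra; auto. }
  rewrite <- (is_RInt_unique _ _ _ _ HI).
  eapply Rle_trans; [apply abs_RInt_le; [lra | eexists; exact HI]|].
  apply RInt_le; [lra | | |].
  - apply (ex_RInt_continuous (V := R_CompleteNormedModule)).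
    intros x; rewrite Rmin_left, Rmax_right by lra; intros Hx.
    apply (continuous_comp dg Rabs); [auto | apply continuous_Rabs].
  - apply (ex_RInt_continuous (V := R_CompleteNormedModule)).
    intros x; rewrite Rmin_left, Rmax_right by lra; intros Hx.
    destruct (continuous_Derive_C1 u x Hu Hx), (continuous_Derive_C1 v x Hv Hx).
    apply continuous_ratio; [simpl; cont | easy | now apply Rgt_not_eq, Hpos].
  - intros x Hx. apply Hle; lra.
Qed.

(** The Busemann function, up to sign and an additive constant, of the ideal
    point [xi] of the real axis. *)
Definition busemann (xi x y : R) : R := ln (((x - xi) ^ 2 + y ^ 2) / y).

(** The gradient of the Busemann function has norm 1: with A = u - xi, its
    derivative along the path is
      (2 A v u' + (v^2 - A^2) v') / (v (A^2 + v^2)),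
    and (2 A v)^2 + (v^2 - A^2)^2 = (A^2 + v^2)^2, so that the bound by the speed
    is the Cauchy-Schwarz inequality. *)
Lemma length_ge_busemann (xi : R) (p q : H2) (u v : R -> R) :
  is_C1_path p q u v ->
  Rabs (busemann xi (xco q) (yco q) - busemann xi (xco p) (yco p)) <= path_length u v.
Proof.
  intros H. assert (H' := H). destruct H' as (Hu & Hv & Hpos & <- & <- & <- & <-).
  apply (length_ge_calibration p q u v (fun t => busemann xi (u t) (v t))
    (fun t => (2 * (u t - xi) * v t * Derive u t
               + (v t * v t - (u t - xi) * (u t - xi)) * Derive v t)
              / (v t * ((u t - xi) * (u t - xi) + v t * v t))) H);
    intros t Ht; assert (Hvt := Hpos t Ht);
    assert (HQ : 0 < (u t - xi) * (u t - xi) + v t * v t)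
      by (apply Rplus_le_lt_0_compat; [apply Rle_0_sqr | now apply Rmult_lt_0_compat]);
    assert (HvQ := Rmult_lt_0_compat _ _ Hvt HQ).
  - unfold busemann. auto_derive.
    + repeat split; try apply Hu; try apply Hv; try lra.
      apply Rdiv_lt_0_compat; [now rewrite !Rmult_1_r | easy].
    + change (fun x => u x) with u. change (fun x => v x) with v.
      field. split; nra.
  - destruct (continuous_Derive_C1 u t Hu Ht), (continuous_Derive_C1 v t Hv Ht).
    apply continuous_ratio; [unfold Rminus; cont | unfold Rminus; cont | lra].
  - unfold speed. set (A := u t - xi). set (V := v t) in *.
    set (U' := Derive u t). set (V' := Derive v t).
    fold A in HQ, HvQ.
    rewrite Rabs_div, (Rabs_right (V * _)) by lra.
    replace (sqrt (U' ^ 2 + V' ^ 2) / V) with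
      (((A * A + V * V) * sqrt (U' ^ 2 + V' ^ 2)) / (V * (A * A + V * V)))
      by (field; lra).
    apply Rmult_le_compat_r; [left; apply Rinv_0_lt_compat; lra|].
    assert (Hs := sqrt_pos (U' ^ 2 + V' ^ 2)).
    rewrite <- (Rabs_right ((A * A + V * V) * _)) by nra.
    apply Rsqr_le_abs_0. rewrite Rsqr_mult, Rsqr_sqrt by nra.
    unfold Rsqr.
    (* Lagrange's identity: this square is the defect in Cauchy-Schwarz. *)
    assert (0 <= (2 * A * V * V' - (V * V - A * A) * U') ^ 2) by apply pow2_ge_0.
    nra.
Qed.

(** The same bound for the ideal point at infinity, whose Busemann function is
    the logarithm of the height. *)
Lemma length_ge_height (p q : H2) (u v : R -> R) :
  is_C1_path p q u v -> Rabs (ln (yco q) - ln (yco p)) <= path_length u v.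
Proof.
  intros H. assert (H' := H). destruct H' as (Hu & Hv & Hpos & _ & <- & _ & <-).
  apply (length_ge_calibration p q u v (fun t => ln (v t))
    (fun t => Derive v t / v t) H);
    intros t Ht; assert (Hvt := Hpos t Ht).
  - auto_derive; [split; [apply Hv|]; easy | change (fun x => v x) with v; field; lra].
  - destruct (continuous_Derive_C1 v t Hv Ht). apply continuous_ratio; [easy..|lra].
  - unfold speed. rewrite Rabs_div, (Rabs_right (v t)) by lra.
    apply Rmult_le_compat_r; [left; now apply Rinv_0_lt_compat|].
    rewrite <- sqrt_Rsqr_abs. apply sqrt_le_1_alt. unfold Rsqr. nra.
Qed.

(** * The distance of two points *)

Lemma C1_on_unit_of_derive (f df : R -> R) :
  (forall t, is_derive f t (df t)) -> (forall t, ex_derive df t) -> C1_on_unit f.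
Proof.
  intros Hf Hdf t _. split; [eexists; apply Hf|].
  apply (continuous_ext df); [intros s; symmetry; apply is_derive_unique, Hf|].
  apply (ex_derive_continuous (V := R_NormedModule)), Hdf.
Qed.

Lemma dist_H2_unique (p q : H2) (l : R) :
  (exists u v, is_C1_path p q u v /\ path_length u v = l) ->
  (forall u v, is_C1_path p q u v -> l <= path_length u v) ->
  dist_H2 p q = l.
Proof.
  intros (u & v & H & <-) Hle. unfold dist_H2.
  erewrite is_glb_Rbar_unique with (l := Finite (path_length u v)); [easy|].
  split.
  - intros r (u' & v' & H' & ->). now apply Hle.
  - intros b Hb. apply Hb. eauto.
Qed.

Lemma path_length_constant_speed (u v du dv : R -> R) (k : R) :
  (forall t, is_derive u t (du t)) -> (forall t, is_derive v t (dv t)) ->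
  (forall t, 0 < v t) ->
  (forall t, du t ^ 2 + dv t ^ 2 = (k * v t) ^ 2) ->
  path_length u v = Rabs k.
Proof.
  intros Hu Hv Hpos Hk. unfold path_length.
  rewrite (RInt_ext _ (fun _ => Rabs k)).
  - rewrite RInt_const. unfold scal; simpl; unfold mult; simpl; ring.
  - intros t _. rewrite (is_derive_unique _ _ _ (Hu t)), (is_derive_unique _ _ _ (Hv t)).
    rewrite Hk, <- Rsqr_pow2, sqrt_Rsqr_abs, Rabs_mult, (Rabs_right (v t)) by (left; apply Hpos).
    apply Rmult_div_l, Rgt_not_eq, Hpos.
Qed.

(** The vertical segment, run at constant speed, realizes the bound of
    [length_ge_height]. *)
Lemma dist_H2_vertical (p q : H2) :
  xco p = xco q -> dist_H2 p q = Rabs (ln (yco q) - ln (yco p)).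
Proof.
  intros Hx. set (k := ln (yco q) - ln (yco p)).
  apply dist_H2_unique; [|intros u v; apply length_ge_height].
  pose (v := fun t => exp (ln (yco p) + k * t)).
  pose (dv := fun t => k * exp (ln (yco p) + k * t)).
  assert (Hu : forall t, is_derive (fun _ => xco p) t (0 : R)) by (intros; auto_derive; easy).
  assert (Hv : forall t, is_derive v t (dv t)) by (intros; unfold v, dv; auto_derive; [easy|ring]).
  assert (Hpos : forall t, 0 < v t) by (intros; apply exp_pos).
  exists (fun _ => xco p), v. split.
  - split; [|split]; [| |split].
    + apply (C1_on_unit_of_derive _ (fun _ => 0) Hu). intros; auto_derive; easy.
    + apply (C1_on_unit_of_derive _ dv Hv). intros; unfold dv; auto_derive; easy.
    + intros; apply Hpos.
    + unfold v, k. repeat split; try easy.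
      * rewrite Rmult_0_r, Rplus_0_r. apply exp_ln, yco_pos.
      * rewrite <- (exp_ln (yco q)) at 2 by apply yco_pos. f_equal; ring.
  - apply (path_length_constant_speed _ v (fun _ => 0) dv); try easy.
    intros t; unfold v, dv; ring.
Qed.

(** The half-circle of centre [c] and radius [r] is parametrized by arc length as
    s |-> (c + r tanh s, r / cosh s). The Busemann function of its right endpoint
    c + r is ln (2 r) - s there, so this arc is calibrated. *)
Lemma dist_H2_semicircle (c r s t : R) (p q : H2) :
  0 < r ->
  xco p = c + r * sinh s / cosh s -> yco p = r / cosh s ->
  xco q = c + r * sinh t / cosh t -> yco q = r / cosh t ->
  dist_H2 p q = Rabs (t - s).
Proof.
  intros Hr Hxp Hyp Hxq Hyq. apply dist_H2_unique.
  - pose (u := fun a => c + r * sinh (s + (t - s) * a) / cosh (s + (t - s) * a)).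
    pose (v := fun a => r / cosh (s + (t - s) * a)).
    pose (du := fun a => (t - s) * r / cosh (s + (t - s) * a) ^ 2).
    pose (dv := fun a => - (t - s) * r * sinh (s + (t - s) * a) / cosh (s + (t - s) * a) ^ 2).
    assert (Hc : forall a, cosh a <> 0) by (intros; apply Rgt_not_eq, cosh_pos).
    assert (Hu : forall a, is_derive u a (du a)).
    { intros a; unfold u, du. auto_derive; [easy|].
      set (w := s + _). field_simplify; [|easy|easy]. rewrite cosh_sqr. field.
      rewrite <- cosh_sqr. apply pow_nonzero, Hc. }
    assert (Hv : forall a, is_derive v a (dv a)).
    { intros a; unfold v, dv. auto_derive; [easy|]. field. easy. }
    assert (Hpos : forall a, 0 < v a)
      by (intros; apply Rdiv_lt_0_compat; [easy | apply cosh_pos]).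
    assert (E0 : s + (t - s) * 0 = s) by ring.
    assert (E1 : s + (t - s) * 1 = t) by ring.
    exists u, v. split.
    + split; [|split]; [| |split].
      * apply (C1_on_unit_of_derive _ du Hu). intros; unfold du; auto_derive.
        exact (pow_nonzero _ 2 (Hc _)).
      * apply (C1_on_unit_of_derive _ dv Hv). intros; unfold dv; auto_derive.
        exact (pow_nonzero _ 2 (Hc _)).
      * intros; apply Hpos.
      * unfold u, v. rewrite E0, E1. repeat split; congruence.
    + apply (path_length_constant_speed u v du dv); try easy.
      intros a; unfold du, dv, v.
      set (w := s + _).
      transitivity (((t - s) * r) ^ 2 * (1 + sinh w ^ 2) / cosh w ^ 4); [field; easy|].
      rewrite <- cosh_sqr. field. easy.
  - assert (HB : forall w, busemann (c + r) (c + r * sinh w / cosh w) (r / cosh w)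
                            = ln (2 * r) - w).
    { intros w. unfold busemann. assert (Hw := cosh_pos w).
      replace (ln (2 * r) - w) with (ln (2 * r * exp (- w)))
        by (rewrite ln_mult, ln_exp; [ring | lra | apply exp_pos]).
      f_equal. replace (exp (- w)) with (cosh w - sinh w) by (unfold cosh, sinh; field).
      transitivity (r * ((cosh w - sinh w) ^ 2 + (cosh w ^ 2 - sinh w ^ 2)) / cosh w).
      - rewrite (cosh_sqr w). field. lra.
      - field. lra. }
    intros u v H. apply (length_ge_busemann (c + r)) in H.
    rewrite Hxp, Hyp, Hxq, Hyq, !HB in H.
    replace (t - s) with (- (ln (2 * r) - t - (ln (2 * r) - s))) by ring.
    now rewrite Rabs_Ropp.
Qed.

(** Two points on different verticals lie on a half-circle centred on the real
    axis, and a point at arc length s on it has sinh s = (x - c) / y and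
    cosh s = r / y; the subtraction formula for cosh then eliminates [c] and [r]. *)
Lemma cosh_dist_H2 (p q : H2) :
  0 <= dist_H2 p q /\
  cosh (dist_H2 p q) =
    1 + ((xco p - xco q) ^ 2 + (yco p - yco q) ^ 2) / (2 * yco p * yco q).
Proof.
  assert (Hp := yco_pos p). assert (Hq := yco_pos q).
  destruct (Req_dec (xco p) (xco q)) as [Hx | Hx].
  - rewrite dist_H2_vertical by easy. split; [apply Rabs_pos|].
    rewrite cosh_Rabs. unfold cosh.
    rewrite Ropp_minus_distr. unfold Rminus at 1 2. rewrite !exp_plus, !exp_Ropp, !exp_ln by easy.
    rewrite Hx. field. lra.
  (* The point of the real axis at equal Euclidean distance from p and q. *)
  - set (c := (xco q ^ 2 + yco q ^ 2 - xco p ^ 2 - yco p ^ 2) / (2 * (xco q - xco p))).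
    set (r := sqrt ((xco p - c) ^ 2 + yco p ^ 2)).
    assert (Hr : 0 < r)
      by (apply sqrt_lt_R0, Rplus_le_lt_0_compat; [apply pow2_ge_0 | now apply pow_lt]).
    assert (Hrp : r ^ 2 = (xco p - c) ^ 2 + yco p ^ 2)
      by (apply pow2_sqrt, Rplus_le_le_0_compat; apply pow2_ge_0).
    assert (Hrq : r ^ 2 = (xco q - c) ^ 2 + yco q ^ 2)
      by (rewrite Hrp; unfold c; field; lra).
    assert (Hparam : forall x y, 0 < y -> r ^ 2 = (x - c) ^ 2 + y ^ 2 ->
      sinh (arcsinh ((x - c) / y)) = (x - c) / y /\ cosh (arcsinh ((x - c) / y)) = r / y).
    { intros x y Hy E. rewrite sinh_arcsinh. split; [easy|].
      assert (E' := cosh_sqr (arcsinh ((x - c) / y))).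
      rewrite sinh_arcsinh in E'.
      apply Rsqr_inj; [left; apply cosh_pos | left; now apply Rdiv_lt_0_compat |].
      replace (Rsqr (r / y)) with (r ^ 2 / y ^ 2) by (unfold Rsqr; field; lra).
      rewrite E, Rsqr_pow2, E'. field; lra. }
    destruct (Hparam _ _ Hp Hrp) as [Sp Cp]. destruct (Hparam _ _ Hq Hrq) as [Sq Cq].
    set (s := arcsinh ((xco p - c) / yco p)) in *.
    set (t := arcsinh ((xco q - c) / yco q)) in *.
    rewrite (dist_H2_semicircle c r s t) by
      (easy || (rewrite ?Sp, ?Cp, ?Sq, ?Cq; field; lra)).
    split; [apply Rabs_pos|].
    rewrite cosh_Rabs, cosh_minus, Sp, Cp, Sq, Cq.
    transitivity ((r ^ 2 + r ^ 2 - 2 * (xco p - c) * (xco q - c)) / (2 * yco p * yco q));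
      [field; lra|].
    rewrite Hrp at 1. rewrite Hrq. field. lra.
Qed.

Lemma dist_H2_sym (p q : H2) : dist_H2 p q = dist_H2 q p.
Proof.
  destruct (cosh_dist_H2 p q) as [Hp Ep], (cosh_dist_H2 q p) as [Hq Eq].
  apply cosh_nonneg_inj; [easy..|]. rewrite Ep, Eq.
  assert (H1 := yco_pos p). assert (H2 := yco_pos q). field. lra.
Qed.

(** * The upper bound: a Ptolemy inequality for exp (d / 2) *)

Lemma Cmod_ptolemy (a b c e : C) :
  Cmod (a - c) * Cmod (b - e) <= Cmod (a - b) * Cmod (c - e) + Cmod (a - e) * Cmod (b - c).
Proof.
  rewrite <- !Cmod_mult.
  replace ((a - c) * (b - e))%C with ((a - b) * (c - e) + (a - e) * (b - c))%C by ring.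
  apply Cmod_triangle.
Qed.

(** Up to the factor 2 sqrt (Im a) sqrt (Im b), this is exp (d / 2) for the
    hyperbolic distance d of [a] and [b]: the first term is sinh (d / 2), the second
    cosh (d / 2). *)
Definition mirror_sum (a b : C) : R := Cmod (a - b) + Cmod (a - Cconj b).

Lemma Cmod_conj_minus (a b : C) : Cmod (Cconj a - b) = Cmod (a - Cconj b).
Proof. rewrite <- Cmod_conj, Cminus_conj, Cconj_conj. easy. Qed.

(** Expanding the products gives four terms on the left and eight on the right.
    Up to conjugating all four points, each left term arises from two choices of
    conjugated points, hence has two Ptolemy bounds; half the sum of these eight
    bounds is exactly the right side. A single choice for each term would use
    some right terms twice. *)
Lemma mirror_sum_ptolemy (a b c e : C) :
  mirror_sum a c * mirror_sum b e
    <= mirror_sum a b * mirror_sum c e + mirror_sum a e * mirror_sum b c.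
Proof.
  unfold mirror_sum.
  assert (P1 := Cmod_ptolemy a b c e).
  assert (P2 := Cmod_ptolemy a (Cconj b) c (Cconj e)).
  assert (P3 := Cmod_ptolemy a b (Cconj c) (Cconj e)).
  assert (P4 := Cmod_ptolemy a (Cconj b) (Cconj c) e).
  assert (P5 := Cmod_ptolemy a b (Cconj c) e).
  assert (P6 := Cmod_ptolemy a (Cconj b) (Cconj c) (Cconj e)).
  assert (P7 := Cmod_ptolemy a b c (Cconj e)).
  assert (P8 := Cmod_ptolemy a (Cconj b) c e).
  rewrite ?Cmod_conj_minus, ?Cconj_conj in *.
  nra.
Qed.

Definition point (p : H2) : C := (xco p, yco p).

Lemma exp_half_dist_H2 (p q : H2) :
  exp (dist_H2 p q / 2) =
    mirror_sum (point p) (point q) / (2 * sqrt (yco p) * sqrt (yco q)).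
Proof.
  destruct (cosh_dist_H2 p q) as [Hd E].
  assert (Hp := yco_pos p). assert (Hq := yco_pos q).
  assert (Hsp := sqrt_lt_R0 _ Hp). assert (Hsq := sqrt_lt_R0 _ Hq).
  assert (Ep := pow2_sqrt _ (Rlt_le _ _ Hp)). assert (Eq := pow2_sqrt _ (Rlt_le _ _ Hq)).
  set (d := dist_H2 p q) in *. replace d with (2 * (d / 2)) in E by field.
  destruct (cosh_sinh_double (d / 2)) as [E1 E2].
  assert (Hs : 0 <= sinh (d / 2)).
  { rewrite <- sinh_0. destruct Hd as [Hd | <-]; [left; apply sinh_lt; lra | right; f_equal; lra]. }
  assert (Hc := cosh_pos (d / 2)).
  set (w := 2 * sqrt (yco p) * sqrt (yco q)).
  assert (Hw : 0 < w) by (unfold w; nra).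
  assert (Ew : w ^ 2 = 4 * yco p * yco q).
  { rewrite <- Ep at 1. rewrite <- Eq at 1. unfold w. ring. }
  assert (Hsinh : sinh (d / 2) = Cmod (point p - point q) / w).
  { apply Rsqr_inj; [easy | apply Rdiv_le_0_compat; [apply Cmod_ge_0 | easy] |].
    rewrite Rsqr_div', !Rsqr_pow2, Ew. unfold Cmod.
    rewrite pow2_sqrt by (apply Rplus_le_le_0_compat; apply pow2_ge_0).
    simpl fst; simpl snd.
    transitivity ((cosh (2 * (d / 2)) - 1) / 2); [lra|]. rewrite E. field. lra. }
  assert (Hcosh : cosh (d / 2) = Cmod (point p - Cconj (point q)) / w).
  { apply Rsqr_inj; [now left | apply Rdiv_le_0_compat; [apply Cmod_ge_0 | easy] |].
    rewrite Rsqr_div', !Rsqr_pow2, Ew. unfold Cmod.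
    rewrite pow2_sqrt by (apply Rplus_le_le_0_compat; apply pow2_ge_0).
    simpl fst; simpl snd.
    transitivity ((cosh (2 * (d / 2)) + 1) / 2); [lra|]. rewrite E. field. lra. }
  rewrite exp_eq_cosh_sinh, Hsinh, Hcosh. unfold mirror_sum. field. lra.
Qed.

Lemma exp_ptolemy_H2 (a b c e : H2) :
  exp ((dist_H2 a c + dist_H2 b e) / 2)
    <= exp ((dist_H2 a b + dist_H2 c e) / 2) + exp ((dist_H2 a e + dist_H2 b c) / 2).
Proof.
  rewrite !Rdiv_plus_distr, !exp_plus, !exp_half_dist_H2.
  assert (H := mirror_sum_ptolemy (point a) (point b) (point c) (point e)).
  assert (Ha := sqrt_lt_R0 _ (yco_pos a)). assert (Hb := sqrt_lt_R0 _ (yco_pos b)).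
  assert (Hc := sqrt_lt_R0 _ (yco_pos c)). assert (He := sqrt_lt_R0 _ (yco_pos e)).
  set (w := 4 * (sqrt (yco a) * sqrt (yco b) * sqrt (yco c) * sqrt (yco e))).
  assert (Hw : 0 < w) by (unfold w; repeat apply Rmult_lt_0_compat; lra).
  apply (Rmult_le_compat_r (/ w)) in H; [|left; now apply Rinv_0_lt_compat].
  unfold w in H. eapply Rle_trans; [eapply Rle_trans; [|exact H]|]; right; field; lra.
Qed.

(** The loss of ln 2 in passing from a Ptolemy inequality to a four-point
    inequality: a sum of two exponentials is at most twice the larger one. *)
Lemma le_max_plus_ln2 (x y z : R) :
  exp (x / 2) <= exp (y / 2) + exp (z / 2) -> x <= Rmax y z + 2 * ln 2.
Proof.
  intros H.
  assert (Hy : exp (y / 2) <= exp (Rmax y z / 2))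
    by (apply exp_le_iff; assert (H1 := Rmax_l y z); lra).
  assert (Hz : exp (z / 2) <= exp (Rmax y z / 2))
    by (apply exp_le_iff; assert (H1 := Rmax_r y z); lra).
  assert (Hx : exp (x / 2) <= exp (Rmax y z / 2 + ln 2)).
  { rewrite exp_plus, exp_ln by lra. lra. }
  apply (proj1 (exp_le_iff _ _)) in Hx. lra.
Qed.

(** As each of the three sums may be the largest, the Ptolemy inequality is used
    in all three arrangements of the quadruple. *)
Lemma delta_H2_le_ln2 (a b c e : H2) : delta H2 dist_H2 a b c e <= ln 2.
Proof.
  assert (P1 := exp_ptolemy_H2 a b c e).
  assert (P2 := exp_ptolemy_H2 a c b e).
  assert (P3 := exp_ptolemy_H2 a b e c).
  rewrite (dist_H2_sym c b) in *. rewrite (dist_H2_sym e c) in *.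
  apply le_max_plus_ln2 in P1, P2, P3.
  unfold delta, middle_sum, largest_sum, smallest_sum.
  fold (sum_ab_ce H2 dist_H2 a b c e) (sum_ac_be H2 dist_H2 a b c e)
    (sum_ae_bc H2 dist_H2 a b c e) in *.
  set (A := sum_ab_ce H2 dist_H2 a b c e) in *.
  set (B := sum_ac_be H2 dist_H2 a b c e) in *.
  set (D := sum_ae_bc H2 dist_H2 a b c e) in *.
  unfold Rmax, Rmin in *. repeat destruct Rle_dec; lra.
Qed.

(** * The lower bound: regular quadrilaterals *)

Definition axis_vertex (r : R) : H2 := mkH2 0 (exp r) (exp_pos r).
Definition circle_vertex (sg r : R) : H2 :=
  mkH2 (sg * (sinh r / cosh r)) (/ cosh r) (Rinv_0_lt_compat _ (cosh_pos r)).

(** The square has its centre at the point i and its vertices at distance x / 2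
    from it, on the imaginary axis and on the unit circle, which are
    perpendicular geodesics through i. *)
Lemma exists_square (x : R) :
  0 <= x ->
  exists (a b c e : H2) (s : R),
    0 <= s /\ cosh s = (1 + cosh x) / 2 /\
    dist_H2 a c = x /\ dist_H2 b e = x /\
    dist_H2 a b = s /\ dist_H2 b c = s /\ dist_H2 c e = s /\ dist_H2 a e = s.
Proof.
  intros Hx. set (r := x / 2).
  assert (Hch := cosh_pos r).
  destruct (cosh_sinh_double r) as [E1 E2].
  replace (2 * r) with x in E1, E2 by (unfold r; field).
  assert (Ecs : cosh r ^ 2 = 1 + sinh r ^ 2) by lra.
  assert (Ex := exp_pos r). assert (Exm := exp_pos (- r)).
  assert (Eone : exp r * exp (- r) = 1) by (rewrite <- exp_plus, <- exp_0; f_equal; ring).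
  assert (Hcosh : cosh r = (exp r + exp (- r)) / 2) by easy.
  exists (axis_vertex r), (circle_vertex 1 r), (axis_vertex (- r)), (circle_vertex (-1) r).
  exists (dist_H2 (axis_vertex r) (circle_vertex 1 r)).
  assert (Hside : forall sg eps, sg ^ 2 = 1 -> eps = r \/ eps = - r ->
    cosh (dist_H2 (axis_vertex eps) (circle_vertex sg r)) = (1 + cosh x) / 2).
  { intros sg eps Hsg Heps.
    destruct (cosh_dist_H2 (axis_vertex eps) (circle_vertex sg r)) as [_ ->]. simpl.
    assert (He := exp_pos eps).
    assert (Hc' : 2 * cosh r * exp eps = exp eps ^ 2 + 1).
    { rewrite Hcosh. destruct Heps as [-> | ->]; nra. }
    transitivity (1 + (sg ^ 2 * (sinh r / cosh r) ^ 2 + (exp eps - / cosh r) ^ 2)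
                        / (2 * exp eps * / cosh r)); [field; lra|].
    rewrite Hsg, E2.
    transitivity ((1 + sinh r ^ 2 + exp eps ^ 2 * cosh r ^ 2) / (2 * exp eps * cosh r));
      [field; lra|].
    rewrite <- Ecs.
    transitivity (cosh r ^ 2 * (exp eps ^ 2 + 1) / (2 * cosh r * exp eps)); [field; lra|].
    rewrite <- Hc'. field. lra. }
  assert (Hd0 := cosh_dist_H2).
  assert (Hone : (1 : R) ^ 2 = 1) by ring.
  assert (Hmone : (-1 : R) ^ 2 = 1) by ring.
  repeat split.
  - apply Hd0.
  - apply Hside; auto.
  - apply cosh_nonneg_inj; [apply Hd0 | easy |].
    destruct (Hd0 (axis_vertex r) (axis_vertex (- r))) as [_ ->]. simpl.
    rewrite E2, Hcosh.
    transitivity (1 + (exp r - exp (- r)) ^ 2 / (2 * (exp r * exp (- r)))); [field; lra|].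
    rewrite Eone. nra.
  - apply cosh_nonneg_inj; [apply Hd0 | easy |].
    destruct (Hd0 (circle_vertex 1 r) (circle_vertex (-1) r)) as [_ ->]. simpl.
    rewrite E1. field. lra.
  - rewrite (dist_H2_sym (circle_vertex 1 r)).
    apply cosh_nonneg_inj; [apply Hd0 .. |]. rewrite !Hside; auto.
  - apply cosh_nonneg_inj; [apply Hd0 .. |]. rewrite !Hside; auto.
  - apply cosh_nonneg_inj; [apply Hd0 .. |]. rewrite !Hside; auto.
Qed.

Lemma square_side_bounds (x s : R) :
  0 <= x -> 0 <= s -> cosh s = (1 + cosh x) / 2 -> s <= x /\ s <= ln (1 + cosh x).
Proof.
  intros Hx Hs E. assert (H1 : 1 <= cosh x).
  { rewrite <- cosh_0. destruct (cosh_sinh_double (x / 2)) as [F _].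
    replace (2 * (x / 2)) with x in F by field. rewrite F, cosh_0.
    assert (0 <= sinh (x / 2) ^ 2) by apply pow2_ge_0. lra. }
  split; [apply cosh_nonneg_le; lra|].
  apply (proj1 (exp_le_iff _ _)). rewrite exp_ln by lra.
  assert (F : cosh s = (exp s + exp (- s)) / 2) by easy.
  assert (0 < exp (- s)) by apply exp_pos. lra.
Qed.

Lemma Gamma_H2_bounds (x : R) :
  0 <= x -> x - ln (1 + cosh x) <= Gamma H2 dist_H2 x <= ln 2.
Proof.
  intros Hx.
  destruct (exists_square x Hx)
    as (a & b & c & e & s & Hs & Es & Hac & Hbe & Hab & Hbc & Hce & Hae).
  destruct (square_side_bounds x s Hx Hs Es) as [Hsx Hsl].
  assert (Hdiam : diameter H2 dist_H2 a b c e = x).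
  { unfold diameter. rewrite Hac, Hbe, Hab, Hbc, Hce, Hae.
    rewrite (Rmax_left x s), (Rmax_right s x) by easy. apply Rmax_left; lra. }
  assert (Hdelta : delta H2 dist_H2 a b c e = x - s).
  { unfold delta, middle_sum, largest_sum, smallest_sum, sum_ab_ce, sum_ac_be, sum_ae_bc.
    rewrite Hac, Hbe, Hab, Hbc, Hce, Hae.
    rewrite (Rmax_left (x + x)), (Rmax_right (s + s)) by lra.
    rewrite (Rmin_right (x + x)), (Rmin_left (s + s)) by lra. field. }
  unfold Gamma. set (E := fun r => _).
  destruct (Lub_Rbar_correct E) as [Hub Hlub].
  assert (Hin : Rbar_le (Finite (x - s)) (Lub_Rbar E)).
  { apply Hub. exists a, b, c, e. now rewrite Hdelta. }
  assert (Hle : Rbar_le (Lub_Rbar E) (Finite (ln 2))).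
  { apply Hlub. intros r (a' & b' & c' & e' & _ & ->). apply delta_H2_le_ln2. }
  destruct (Lub_Rbar E) as [l | |]; simpl in *; [lra | easy..].
Qed.

(** Factoring exp x out of 1 + cosh x leaves
      exp (- x) + 1 / 2 + exp (- 2 x) / 2,
    a continuous function of exp (- x) that tends to 1 / 2. *)
Lemma is_lim_square_delta : is_lim (fun x => x - ln (1 + cosh x)) p_infty (ln 2).
Proof.
  apply is_lim_ext with (fun x => - ln (exp (- x) + / 2 + exp (- x) * exp (- x) / 2)).
  { intros x.
    assert (Hx := exp_pos x). assert (Hm := exp_pos (- x)).
    assert (Eone : exp x * exp (- x) = 1) by (rewrite <- exp_plus, <- exp_0; f_equal; ring).
    replace (_ + _ + _) with (exp (- x) * (1 + cosh x)).
    - rewrite ln_mult, ln_exp by (try apply Rplus_lt_0_compat; try apply cosh_pos; lra). ring.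
    - unfold cosh. nra. }
  assert (H0 : is_lim (fun x => exp (- x)) p_infty 0).
  { apply (is_lim_comp exp Ropp p_infty 0 m_infty).
    - apply is_lim_exp_m.
    - apply (is_lim_opp (fun x => x) p_infty p_infty), is_lim_id.
    - exists 0. easy. }
  replace (ln 2) with (- ln (0 + / 2 + 0 * 0 / 2)).
  2: { replace (0 + / 2 + 0 * 0 / 2) with (/ 2) by field. rewrite ln_Rinv by lra. ring. }
  apply (is_lim_comp_continuous _ (fun z => - ln (z + / 2 + z * z / 2)) p_infty 0 H0).
  apply (ex_derive_continuous (V := R_NormedModule)). auto_derive. lra.
Qed.

(** * The limit *)

Theorem corollary3p7 : is_lim (Gamma H2 dist_H2) p_infty (Finite (ln 2)).
Proof.
  apply (is_lim_le_le_loc (fun x => x - ln (1 + cosh x)) (fun _ => ln 2)).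
  - exists 0. intros x Hx. apply Gamma_H2_bounds. lra.
  - apply is_lim_square_delta.
  - apply is_lim_const.
Qed.
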